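(* Let $R$ be a positive integer. Let $G$ be a graph and $\mathcal{H}$ be a hypergraph with $V(G)=V(\mathcal{H})$ and $\mathrm{rank}(\mathcal{H})\le R$ such that $|f|\ge 3$ for every $f\in E(\mathcal{H})$. Let $\beta$ be a real number with $0.6550826\,R\le\beta\le R$. Let $$a:=\Big\lceil \Delta(G)+\beta+\max_{v\in V(G)}\big(d_{\mathcal{H}}(v)\cdot b(v)\big)\Big\rceil,$$ where $$b(v):=\max\Big\{2\beta^{1-\lceil \mathrm{mr}_{\mathcal{H}}(v)/2\rceil}(\log R)^{2\lceil \mathrm{mr}_{\mathcal{H}}(v)/2\rceil},\ (1-10^{-8})^{(\log R)^2}\Big\}.$$ If $R\ge e^{3.1\cdot 10^8}$, then for every $a$-assignment $L$ of $G$, there are at least $\beta^{|V(G)|}$ proper conflict-free $L$-colorings of $(G,\mathcal{H})$.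
   Context: Graphs and hypergraphs are finite, graphs are simple, and every edge of a hypergraph is a nonempty set of vertices (the edge set may be empty). $\log$ is the natural logarithm and $e$ its base. $d_{\mathcal{H}}(v)$ is the number of edges of $\mathcal{H}$ containing $v$, and $\Delta(G)$ is the maximum degree of $G$. The rank of $\mathcal{H}$ is $\mathrm{rank}(\mathcal{H})=\max_{f\in E(\mathcal{H})}|f|$ (with value $0$ if there are no edges), and $\mathrm{mr}_{\mathcal{H}}(v)=\min\{|f|: f\in E(\mathcal{H}),\ v\in f\}$. If $v$ lies in no edge of $\mathcal{H}$, the product $d_{\mathcal{H}}(v)\cdot b(v)$ is read as $0$. A coloring is a map $\varphi\colon V(G)\to\mathbb{Z}^+$. A proper conflict-free coloring of $(G,\mathcal{H})$ is a coloring that is proper on $G$ (adjacent vertices get different colors) and such that for every $f\in E(\mathcal{H})$ some color is used by $\varphi$ on exactly one vertex of $f$. An $a$-assignment $L$ assigns to each vertex $v$ a set $L(v)\subseteq\mathbb{Z}^+$ with $|L(v)|\ge a$; an $L$-coloring is a coloring with $\varphi(v)\in L(v)$ for all $v$. *)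

(* Defs.v *)
From HB Require Import structures.
From mathcomp Require Import all_boot all_order all_algebra.
From mathcomp Require Import all_classical all_reals all_analysis.

Set Implicit Arguments.
Unset Strict Implicit.
Unset Printing Implicit Defensive.

Import Order.TTheory GRing.Theory Num.Theory.

Local Open Scope classical_set_scope.
Local Open Scope ring_scope.

Record graph (V : finType) := Graph {
  adj : rel V;
  adj_sym : symmetric adj;
  adj_irrefl : irreflexive adj }.

Record hypergraph (V : finType) := Hypergraph {
  hedges : {set {set V}};
  hedges_neq0 : finset.set0 \notin hedges }.

Section Colorings.
Variable V : finType.
Implicit Types (G : graph V) (H : hypergraph V) (v : V).

Definition gdeg G v : nat := #|[set w | adj G v w]%SET|.

Definition max_deg G : nat := (\max_(v : V) gdeg G v)%N.

Definition hdeg H v : nat := #|[set f in hedges H | v \in f]%SET|.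

Definition rank H : nat := (\max_(f in hedges H) #|f|)%N.

(* Every edge has at most #|V| vertices, so the default #|V| does not affect
   the minimum as soon as v lies in some edge.  If v lies in no edge the value
   is irrelevant: it is only used multiplied by hdeg H v = 0. *)
Definition min_rank H v : nat :=
  (\big[minn/#|V|]_(f in hedges H | v \in f) #|f|)%N.

(* uphalf n is the ceiling of n / 2; the power of beta has an integer,
   possibly negative, exponent, and the last power has a real exponent. *)
Definition weight (K : realType) (R : nat) (beta : K) H v : K :=
  let k := uphalf (min_rank H v) in
  Num.max (2 * beta ^ (1 - k%:Z) * ln (R%:R : K) ^+ (2 * k))
          ((1 - 10 ^- 8) `^ (ln (R%:R : K) ^+ 2)).

(* The maximum is taken over nonnegative reals when beta >= 0, so starting it
   at 0 is harmless (and gives a value when V is empty). *)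
Definition list_size (K : realType) (R : nat) (beta : K) G H : int :=
  Num.ceil ((max_deg G)%:R + beta +
            \big[Num.max/0]_(v : V) ((hdeg H v)%:R * weight R beta H v)).

Definition proper_coloring G (phi : {ffun V -> nat}) : Prop :=
  forall v w, adj G v w -> phi v <> phi w.

Definition conflict_free H (phi : {ffun V -> nat}) : Prop :=
  forall f, f \in hedges H ->
    exists c : nat, #|[set v in f | phi v == c]%SET| = 1%N.

(* Colors are positive integers; the sets L v may be infinite. *)
Definition assignment (a : nat) (L : V -> set nat) : Prop :=
  forall v, L v `<=` [set c | (0 < c)%N] /\ (`I_a #<= L v)%card.

Definition pcf_list_colorings G H (L : V -> set nat) : set {ffun V -> nat} :=
  [set phi | [/\ proper_coloring G phi, conflict_free H phi
             & forall v, L v (phi v)]].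

End Colorings.

(* Lower bound by a real number on the number of elements of a possibly
   infinite set. *)
Definition at_least (K : realType) (T : Type) (x : K) (A : set T) : Prop :=
  exists2 n : nat, x <= n%:R & (`I_n #<= A)%card.

(* Main.v *)
Require Import Defs.
From HB Require Import structures.
From mathcomp Require Import all_boot all_order all_algebra.
From mathcomp Require Import all_classical all_reals all_analysis.
From mathcomp Require Import ring lra zify.

(** Fix lists of size [a] and call a coloring of a vertex set [T] good when it
    is proper on [T], takes its colors from the lists, and is conflict-free for
    every edge contained in [T].  Following Rosenfeld's counting method, the
    number of good colorings is shown to grow by a factor at least [beta] each
    time a vertex is added ([good_colorings_extend]); starting from the single
    coloring of the empty set, this yields [beta ^+ #|V|] good colorings of [V].

    A good coloring of [S] has at least [a - max_deg G] extensions to a new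
    vertex [v] that respect adjacency.  Such an extension fails only when, on
    some edge [f] through [v], no color occurs exactly once, that is, when the
    partition [P] of [f] into color classes has no singleton block.  Given [P],
    the coloring can be recovered after keeping in [f] only one vertex other
    than [v] per block, so it is encoded by a good coloring of a subset of [S]
    with [#|f| - #|P| - 1] vertices fewer; by induction there are at most
    [beta ^- (#|f| - #|P| - 1)] times as many of those as good colorings of [S]
    ([card_extensions_partition]).  Hence the edge [f] costs at most
    [edge_cost beta f], the sum of these ratios over all singleton-free
    partitions, and it remains to bound that sum by the weight of [v].

    There are at most [#|f|! * s ^+ k / k!] singleton-free partitions of [f]
    with [k] blocks, where [s = 18 / 25] bounds the sum of the [1 / j!] over
    [2 <= j] ([card_singleton_free_with_le]), so the generating polynomial of
    these partitions by number of blocks is at most [#|f|! * expR (s * x)]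
    ([singleton_free_poly_le]).  This is the bound by the exponential generating
    function [expR (x * (expR t - 1 - t))], taken at [t = 1].  Write [l] for
    the logarithm of [R].  If [#|f| <= l ^+ 2], comparing [beta] with [#|f|]
    gives the first term of the weight ([edge_cost_small]).  If
    [l ^+ 2 < #|f|], comparing [beta] with [13 / 20 * #|f|] shows that the cost
    decays exponentially in [#|f|], at a rate far beyond what the second term of
    the weight requires ([edge_cost_large]). *)

Set Implicit Arguments.
Unset Strict Implicit.
Unset Printing Implicit Defensive.

Import Order.TTheory GRing.Theory Num.Theory.

Local Open Scope ring_scope.

(** * Partitions without singleton blocks *)

Section SingletonFreePartitions.
Import mathcomp.boot.fintype mathcomp.boot.finset.
Context (T : finType) (K : realType).
Implicit Types (A D : {set T}) (P : {set {set T}}).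

Definition singleton_free A : {set {set {set T}}} :=
  [set P | partition P A & [forall D in P, (1 < #|D|)%N]].

Lemma singleton_freeP A P :
  reflect (partition P A /\ (forall D, D \in P -> (1 < #|D|)%N))
          (P \in singleton_free A).
Proof.
rewrite inE; apply: (iffP andP) => -[partP]; first by move/forall_inP.
by move=> blockP; split=> //; apply/forall_inP.
Qed.

Lemma double_card_singleton_free A P :
  P \in singleton_free A -> (#|P|.*2 <= #|A|)%N.
Proof.
case/singleton_freeP => partP blockP.
rewrite (card_partition partP) -muln2 -sum_nat_const.
exact: leq_sum.
Qed.

Definition singleton_free_with k A : {set {set {set T}}} :=
  [set P in singleton_free A | #|P| == k].

Lemma card_singleton_free_with0 A : (#|singleton_free_with 0 A| <= 1)%N.
Proof.
rewrite -(cards1 (set0 : {set {set T}})); apply: subset_leq_card.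
by apply/subsetP => P; rewrite !inE cards_eq0 => /andP[].
Qed.

(** Removing a given block is injective on the partitions that contain it. *)
Lemma card_singleton_free_block k A D :
  (#|[set P in singleton_free_with k.+1 A | D \in P]|
     <= #|singleton_free_with k (A :\: D)|)%N.
Proof.
have injD : {in [set P in singleton_free_with k.+1 A | D \in P] &,
    injective (fun P => P :\ D)}.
  move=> P Q; rewrite !inE => /andP[_ DP] /andP[_ DQ] eqPQ.
  by rewrite -(setD1K DP) eqPQ setD1K.
rewrite -(card_in_imset injD); apply: subset_leq_card.
apply/subsetP => _ /imsetP[P + ->].
rewrite inE => /andP[]; rewrite inE => /andP[/singleton_freeP[partP blockP]].
move=> /eqP cardP DP; rewrite inE; apply/andP; split.
  apply/singleton_freeP; split; first exact: partitionD1.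
  by move=> E /setD1P[_ /blockP].
by move: cardP; rewrite (cardsD1 D P) DP add1n => -[->].
Qed.

(** The full series sums to [expR 1 - 2], slightly below [18 / 25].  The partial
    sums are bounded by induction once the tail bound [1 / (n * n!)] is added to
    them; this is small enough from [n = 4] on. *)
Lemma sum_inv_fact_le m :
  \sum_(2 <= j < m.+1) (j`!%:R)^-1 <= 18 / 25 :> K.
Proof.
have [fact2 fact3 fact4] : [/\ 2`! = 2, 3`! = 6 & 4`! = 24]%N by [].
have tail n : (4 <= n)%N ->
    \sum_(2 <= j < n.+1) (j`!%:R)^-1 + (n%:R * n`!%:R)^-1 <= 18 / 25 :> K.
  elim: n => // n IHn; rewrite leq_eqVlt => /predU1P[<-|].
    by do 3 rewrite big_ltn //; rewrite big_geq // fact2 fact3 fact4; lra.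
  rewrite ltnS => n4; rewrite big_nat_recr //=; last lia.
  apply: le_trans (IHn n4); rewrite -addrA lerD2l.
  have n0 : (0 : K) < n%:R by rewrite ltr0n; lia.
  have f0 : (0 : K) < n`!%:R by rewrite ltr0n fact_gt0.
  rewrite factS natrM -natr1.
  have -> : ((n%:R + 1) * n`!%:R)^-1
      + ((n%:R + 1) * ((n%:R + 1) * n`!%:R))^-1
      = (n%:R * n`!%:R)^-1 - (n%:R * (n%:R + 1) ^+ 2 * n`!%:R)^-1 :> K.
    by field; rewrite !lt0r_neq0 //; lra.
  rewrite gerBl invr_ge0 !mulr_ge0 ?exprn_ge0 //; lra.
have [m4|m4] := leqP 4 m.
  apply: le_trans (tail m m4); rewrite lerDl invr_ge0.
  by rewrite mulr_ge0.
case: m m4 => [|[|[|[|m]]]]  // _.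
- by rewrite big_geq //; lra.
- by rewrite big_geq //; lra.
- by rewrite big_ltn // big_geq // fact2; lra.
- by do 2 rewrite big_ltn //; rewrite big_geq // fact2 fact3; lra.
Qed.

(** There are [#|A|! / (j! * (#|A| - j)!)] subsets of size [j], so size [j]
    contributes [#|A|! / j!]. *)
Lemma sum_card_subsets_fact A :
  \sum_(D : {set T} | (D \subset A) && (1 < #|D|)%N)
     ((#|A :\: D|)`!%:R : K) <= (#|A|)`!%:R * (18 / 25).
Proof.
set m := #|A|.
(* Classify the subsets by size; the truncation at [m] only serves to land in
   ['I_m.+1]. *)
pose h (D : {set T}) : 'I_m.+1 := inord (minn #|D| m).
have hE (D : {set T}) : D \subset A -> h D = #|D| :> nat.
  move=> /subset_leq_card Dm; rewrite /h (minn_idPl Dm) inordK //.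
rewrite (partition_big h (fun j : 'I_m.+1 => (1 < j)%N)) /=; last first.
  by move=> D /andP[DA D1]; rewrite hE.
apply: (@le_trans _ _ (\sum_(j < m.+1 | (1 < j)%N) m`!%:R * (j`!%:R)^-1)).
  apply: ler_sum => j j1.
  have jm : (j <= m)%N by rewrite -ltnS.
  rewrite (eq_bigr (fun=> (m - j)`!%:R)); last first.
    move=> D /andP[/andP[DA _] /eqP hD].
    by rewrite cardsDS // -(hE D DA) hD.
  rewrite (eq_bigl (mem [set D : {set T} | D \subset A & #|D| == j])); last first.
    move=> D; rewrite /= in_set; case: (boolP (D \subset A)) => //= DA.
    by rewrite -val_eqE /= hE //; case: eqP => [->|_]; rewrite ?j1 ?andbF.
  rewrite sumr_const cards_draws -mulrnA.
  rewrite ler_pdivlMr ?ltr0n ?fact_gt0 // -natrM ler_nat -/m.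
  by apply: eq_leq; rewrite -(bin_fact jm); ring.
rewrite -mulr_sumr; apply: ler_wpM2l => //.
rewrite -(big_mkord (fun j => (1 < j)%N) (fun j => (j`!%:R)^-1)) /=.
have [m1|m1] := ltnP m 1.
  move: m1; rewrite ltnS leqn0 => /eqP ->.
  rewrite big_nat_cond big1; first lra.
  by move=> j; case: j => [|j]; rewrite ?andbF.
rewrite (@big_cat_nat _ _ _ 2) //= big_nat_cond big1 ?add0r; last first.
  by move=> j; case: j => [|[|j]].
rewrite big_nat_cond (eq_bigl (fun j => (2 <= j < m.+1)%N)); last first.
  by move=> j; rewrite -andbA; case: (2 <= j)%N => //=; rewrite andbT.
rewrite -big_nat; exact: sum_inv_fact_le.
Qed.

(** Counting pairs of a partition with [k.+1] blocks and one of its blocks [D]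
    in two ways: each partition occurs [k.+1] times, and after removing [D] a
    partition of [A :\: D] with [k] blocks remains. *)
Lemma card_singleton_free_with_le k A :
  (#|singleton_free_with k A|%:R : K)
    <= (#|A|)`!%:R * ((18 / 25) ^+ k / k`!%:R).
Proof.
elim: k A => [|k IHk] A.
  rewrite expr0 fact0 divr1 mulr1 ler_nat.
  exact: leq_trans (card_singleton_free_with0 A) (fact_gt0 _).
have k0 : (0 : K) < k.+1%:R by rewrite ltr0n.
rewrite factS natrM exprS.
have -> : (18 / 25) * (18 / 25) ^+ k / (k.+1%:R * k`!%:R)
    = (18 / 25) * ((18 / 25) ^+ k / k`!%:R) / k.+1%:R :> K.
  by rewrite invfM; ring.
rewrite [leRHS]mulrA ler_pdivlMr //.
have count : (#|singleton_free_with k.+1 A| * k.+1 <=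
    \sum_(D : {set T} | (D \subset A) && (1 < #|D|)%N)
       #|[set P in singleton_free_with k.+1 A | D \in P]|)%N.
  rewrite -sum_nat_const.
  rewrite (eq_bigr (fun P : {set {set T}} => \sum_(D in P) 1)%N); last first.
    by move=> P; rewrite sum1_card inE => /andP[_ /eqP ->].
  rewrite (exchange_big_dep
    (fun D : {set T} => (D \subset A) && (1 < #|D|)%N)) /=; last first.
    move=> P D; rewrite inE => /andP[/singleton_freeP[partP blockP] _] DP.
    by rewrite (partitionS partP DP) blockP.
  by apply: leq_sum => D _; rewrite sum1dep_card.
rewrite -natrM; apply: le_trans (_ : _ <= \sum_(D : {set T} | (D \subset A)
    && (1 < #|D|)%N) (#|A :\: D|)`!%:R * ((18 / 25) ^+ k / k`!%:R)) _.
  move: count; rewrite -(ler_nat K) => /le_trans; apply.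
  rewrite natr_sum; apply: ler_sum => D _.
  apply: le_trans (IHk _); rewrite ler_nat.
  exact: card_singleton_free_block.
rewrite -mulr_suml [leRHS]mulrA; apply: ler_wpM2r.
  by rewrite divr_ge0 // exprn_ge0 //; lra.
exact: sum_card_subsets_fact.
Qed.

Lemma exp_partial_sum_le (x : K) n : 0 <= x ->
  \sum_(k < n) x ^+ k / k`!%:R <= expR x.
Proof.
move=> x0; rewrite -(big_mkord xpredT (fun k => x ^+ k / k`!%:R)) /expR.
apply: (@nondecreasing_cvgn_le K (series (exp_coeff x))); last first.
  exact: is_cvg_series_exp_coeff.
by apply: nondecreasing_series => i _ _; exact: exp_coeff_ge0.
Qed.

Definition singleton_free_poly A (x : K) : K :=
  \sum_(P in singleton_free A) x ^+ #|P|.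

Lemma singleton_free_poly_le A (x : K) : 0 <= x ->
  singleton_free_poly A x <= (#|A|)`!%:R * expR (18 / 25 * x).
Proof.
move=> x0; rewrite /singleton_free_poly.
pose h P : 'I_#|A|.+1 := inord #|P|.
have hE P : P \in singleton_free A -> h P = #|P| :> nat.
  by move=> /double_card_singleton_free PA; rewrite inordK //; lia.
rewrite (partition_big h predT) //=.
apply: (@le_trans _ _ (\sum_(k < #|A|.+1)
    (#|A|)`!%:R * ((18 / 25 * x) ^+ k / k`!%:R))); last first.
  rewrite -mulr_sumr ler_wpM2l //; apply: exp_partial_sum_le; lra.
apply: ler_sum => k _.
rewrite (eq_bigr (fun=> x ^+ k)); last first.
  by move=> P /andP[PA /eqP <-]; rewrite hE.
rewrite (eq_bigl (mem (singleton_free_with k A))); last first.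
  move=> P; rewrite [RHS]in_set; case: (boolP (P \in _)) => //= PA.
  by rewrite -val_eqE /= hE.
rewrite sumr_const exprMn -[leLHS]mulr_natl.
have := card_singleton_free_with_le k A.
move=> /(ler_wpM2r (exprn_ge0 k x0)) /le_trans; apply.
by rewrite le_eqVlt; apply/predU1P; left; ring.
Qed.

End SingletonFreePartitions.

(** * Counting partial colorings *)

Section PartialColorings.
Import mathcomp.boot.fintype mathcomp.boot.finset.
Context (V C : finType) (c0 : C) (G : graph V) (H : hypergraph V).
Context (L : V -> {set C}).
Implicit Types (S T f : {set V}) (phi psi : {ffun V -> C}) (v : V).

Definition uniquely_colored phi f : bool :=
  [exists c, #|[set x in f | phi x == c]| == 1%N].

(** Partial colorings are total functions that take the junk value [c0] outside
    their domain [T]; this makes a coloring of [T] determined by its values on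
    [T].  The color [c0] may also occur in the lists. *)
Definition good T phi : bool :=
  [&& [forall x, phi x \in if x \in T then L x else [set c0]],
      [forall x in T, forall y in T, adj G x y ==> (phi x != phi y)]
    & [forall f in hedges H, (f \subset T) ==> uniquely_colored phi f]].

Definition good_colorings T : {set {ffun V -> C}} := [set phi | good T phi].

Definition restr T phi : {ffun V -> C} :=
  [ffun x => if x \in T then phi x else c0].

Lemma goodP T phi :
  reflect [/\ forall x, x \in T -> phi x \in L x,
              forall x, x \notin T -> phi x = c0,
              forall x y, x \in T -> y \in T -> adj G x y -> phi x != phi y
            & forall f, f \in hedges H -> f \subset T -> uniquely_colored phi f]
          (good T phi).
Proof.
apply: (iffP and3P) => [[/forallP listT /forall_inP propT /forall_inP cfT]|].
  split.
  - by move=> x xT; have := listT x; rewrite xT.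
  - by move=> x xT; have := listT x; rewrite (negbTE xT) inE => /eqP.
  - by move=> x y xT yT; move/forall_inP: (propT x xT) => /(_ y yT)/implyP.
  - by move=> f fH; move/implyP: (cfT f fH).
move=> [listT offT propT cfT]; split.
- apply/forallP => x; case: ifPn => xT; first exact: listT.
  by rewrite inE offT.
- apply/forall_inP => x xT; apply/forall_inP => y yT; apply/implyP.
  exact: propT.
- by apply/forall_inP => f fH; apply/implyP; exact: cfT.
Qed.

Lemma eq_uniquely_colored phi psi f :
  {in f, phi =1 psi} -> uniquely_colored phi f = uniquely_colored psi f.
Proof.
move=> eqf; apply: eq_existsb => c; congr (#|pred_of_set _| == _).
by apply/setP => x; rewrite !inE; case: (boolP (x \in f)) => //= /eqf ->.
Qed.

Lemma restr_good S T phi : S \subset T -> good T phi -> good S (restr S phi).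
Proof.
move=> /fintype.subsetP ST /goodP[listT offT propT cfT].
have inS x : x \in S -> restr S phi x = phi x by rewrite ffunE => ->.
apply/goodP; split.
- by move=> x xS; rewrite inS // listT // ST.
- by move=> x xS; rewrite ffunE (negbTE xS).
- by move=> x y xS yS; rewrite !inS //; apply: propT; exact: ST.
- move=> f fH /fintype.subsetP fS; rewrite (@eq_uniquely_colored _ phi).
    by apply: cfT => //; apply/fintype.subsetP => x /fS /ST.
  by move=> x /fS /inS.
Qed.

Lemma preim_partition_singleton_free phi f :
  ~~ uniquely_colored phi f -> preim_partition phi f \in singleton_free f.
Proof.
move=> /existsPn noc; apply/singleton_freeP; split.
  exact: preim_partitionP.
move=> _ /imsetP[x xf ->].
have -> : [set y in f | phi x == phi y] = [set y in f | phi y == phi x].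
  by apply/setP => y; rewrite !inE eq_sym.
have := noc (phi x); rewrite neq_ltn => /orP[|//].
by rewrite ltnS leqn0 cards_eq0 => /eqP/setP/(_ x); rewrite !inE xf eqxx.
Qed.

Lemma preim_partition_const phi f P D x y :
  preim_partition phi f = P -> D \in P -> x \in D -> y \in D -> phi x = phi y.
Proof.
by move=> <- /imsetP[z _ ->]; rewrite !inE => /andP[_ /eqP<-] /andP[_ /eqP<-].
Qed.

(** Requiring [phi v] to differ from the color of every neighbor, colored or
    not, costs at most [max_deg G] colors. *)
Definition extensions S v : {set {ffun V -> C}} :=
  [set phi : {ffun V -> C} |
    [&& [forall x, phi x \in if x \in v |: S then L x else [set c0]],
                 good S (restr S phi)
               & [forall w, adj G v w ==> (phi v != phi w)]]].

(** Every block of [P] has at least two vertices, so it has a representative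
    other than [v].  A coloring whose classes on [f] are the blocks of [P] is
    determined by its restriction to [S'], the vertices of [S] that are outside
    [f] or representatives. *)
Lemma card_extensions_partition S v f P :
    v \notin S -> v \in f -> f \subset v |: S -> P \in singleton_free f ->
  exists S', [/\ S' \subset S, #|S :\: S'| = (#|f| - #|P|).-1
    & (#|[set phi in extensions S v | preim_partition phi f == P]|
        <= #|good_colorings S'|)%N].
Proof.
move=> vS vf /fintype.subsetP fvS /singleton_freeP[partP blockP].
pose rep D := odflt v [pick x in D :\ v].
have repP D : D \in P -> rep D \in D :\ v.
  move=> DP; rewrite /rep; case: pickP => [x //|D0].
  have := blockP D DP; rewrite (cardsD1 v D) (eq_card0 D0).
  by case: (v \in D).
have rep_inj : {in P &, injective rep}.
  move=> D E DP EP eqDE.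
  have /setD1P[_ rD] := repP D DP; have /setD1P[_ rE] := repP E EP.
  have trP := partition_trivIset partP.
  by rewrite -(def_pblock trP DP rD) eqDE (def_pblock trP EP rE).
pose X := rep @: P.
have Xf : X \subset f :\ v.
  apply/fintype.subsetP => _ /imsetP[D DP ->].
  have /setD1P[rv rD] := repP D DP; rewrite in_setD1 rv.
  exact: fintype.subsetP (partitionS partP DP) _ rD.
have fS x : x \in f :\ v -> x \in S.
  by move=> /setD1P[xv /fvS/setU1P[/eqP|//]]; rewrite (negbTE xv).
exists ((S :\: f) :|: X); split.
- apply/fintype.subsetP => x /setUP[/setDP[]//|].
  by move=> /(fintype.subsetP Xf) /fS.
- have -> : S :\: ((S :\: f) :|: X) = (f :\ v) :\: X.
    apply/setP => x; move/implyP: (fS x).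
    have /implyP : x \in S -> x != v by apply: contraTneq => ->.
    rewrite !inE.
    by case: (x == v); case: (x \in S); case: (x \in f); case: (x \in X).
  rewrite cardsDS // (card_in_imset rep_inj) (cardsD1 v f) vf; lia.
- set A := [set phi in _ | _]; set S' := _ :|: _.
  have S'S : S' \subset S.
    apply/fintype.subsetP => x /setUP[/setDP[]//|].
    by move=> /(fintype.subsetP Xf) /fS.
  have injA : {in A &, injective (restr S')}.
    move=> phi psi /setIdP[+ /eqP phiP] /setIdP[+ /eqP psiP] eqr.
    rewrite !inE => /and3P[/forallP offphi _ _] /and3P[/forallP offpsi _ _].
    have inS' x : x \in S' -> phi x = psi x.
      by move=> xS'; move/ffunP/(_ x): eqr; rewrite !ffunE xS'.
    apply/ffunP => x; case: (boolP (x \in f)) => xf.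
      have xc : x \in cover P by rewrite (cover_partition partP).
      have DP := pblock_mem xc; have xD : x \in pblock P x by rewrite mem_pblock.
      have /setD1P[_ rD] := repP _ DP.
      rewrite (preim_partition_const phiP DP xD rD).
      rewrite (preim_partition_const psiP DP xD rD).
      by apply: inS'; rewrite inE imset_f ?orbT.
    have xv : x != v by apply: contraNneq xf => ->.
    case: (boolP (x \in S)) => xS.
      by apply: inS'; rewrite !inE xf xS.
    have := offphi x; have := offpsi x.
    by rewrite !inE (negbTE xv) (negbTE xS) !inE => /eqP -> /eqP ->.
  rewrite -(card_in_imset injA); apply: subset_leq_card.
  apply/fintype.subsetP => _ /imsetP[phi + ->].
  move=> /setIdP[+ _]; rewrite !inE => /and3P[_ /(restr_good S'S) + _].
  congr (good _ _); apply/ffunP => x; rewrite !ffunE.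
  by case: ifP => // /(fintype.subsetP S'S) ->.
Qed.

Lemma card_extensions a S v :
    (a <= #|L v|)%N -> v \notin S ->
  (a * #|good_colorings S|
     <= #|extensions S v| + max_deg G * #|good_colorings S|)%N.
Proof.
move=> aL vS.
have -> : #|extensions S v| =
    (\sum_(psi in good_colorings S)
       #|[set phi in extensions S v | restr S phi == psi]|)%N.
  rewrite -sum1_card.
  rewrite (partition_big (restr S) (mem (good_colorings S))) /=; last first.
    by move=> phi; rewrite !inE => /and3P[].
  by apply: eq_bigr => psi _; rewrite sum1dep_card.
rewrite mulnC [(max_deg G * _)%N]mulnC -!sum_nat_const -big_split /=.
apply: leq_sum => psi; rewrite inE => good_psi.
have /goodP[listS offS _ _] := good_psi.
have degv : (gdeg G v <= max_deg G)%N by exact: (leq_bigmax v).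
apply: leq_trans aL _; apply: leq_trans (leq_add _ degv).
  rewrite -(cardsID (psi @: [set w | adj G v w]) (L v)) addnC.
  apply: leq_add (leqnn _) _.
  apply: leq_trans (subset_leq_card (subsetIr _ _)) _.
  exact: leq_imset_card.
pose upd c : {ffun V -> C} := [ffun x => if x == v then c else psi x].
have updv c : upd c v = c by rewrite ffunE eqxx.
have upd_inj : injective upd.
  by move=> c d /ffunP/(_ v); rewrite !updv.
rewrite -(card_imset _ upd_inj); apply: subset_leq_card.
apply/fintype.subsetP => _ /imsetP[c /setDP[cL cN] ->].
have restr_upd : restr S (upd c) = psi.
  apply/ffunP => x; rewrite !ffunE; case: ifPn => xS; last by rewrite offS.
  by case: eqP xS vS => // -> ->.
rewrite !inE restr_upd eqxx good_psi andbT /=; apply/andP; split.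
  apply/forallP => x; rewrite !inE ffunE; case: eqP => [->//|_] /=.
  by case: ifPn => xS; rewrite ?listS // inE offS.
apply/forallP => w; apply/implyP => vw; rewrite updv ffunE.
case: (w =P v) vw => [->|_ vw]; first by rewrite adj_irrefl.
by apply: contraNneq cN => ->; rewrite imset_f // inE.
Qed.


Lemma good_extension S v phi :
    phi \in extensions S v ->
    (forall f, f \in hedges H -> v \in f -> f \subset v |: S ->
      uniquely_colored phi f) ->
  good (v |: S) phi.
Proof.
rewrite inE => /and3P[/forallP listphi /goodP[_ _ propS cfS] /forallP propv] cfv.
have inS x : x \in S -> restr S phi x = phi x by rewrite ffunE => ->.
apply/goodP; split.
- by move=> x xvS; have := listphi x; rewrite xvS.
- by move=> x xvS; have := listphi x; rewrite (negbTE xvS) inE => /eqP.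
- move=> x y /setU1P[->|xS] /setU1P[->|yS].
  + by rewrite adj_irrefl.
  + by move: (propv y) => /implyP.
  + by rewrite adj_sym eq_sym; move: (propv x) => /implyP.
  + by rewrite -(inS x) // -(inS y) //; exact: propS.
- move=> f fH fvS; case: (boolP (v \in f)) => vf; first exact: cfv.
  have fS : f \subset S.
    apply/fintype.subsetP => x xf.
    move/fintype.subsetP/(_ x xf)/setU1P: fvS => [xv|//].
    by rewrite -xv xf in vf.
  rewrite (@eq_uniquely_colored _ (restr S phi)) ?cfS // => x xf.
  by rewrite inS // (fintype.subsetP fS).
Qed.

Context (K : realType) (beta : K) (beta_gt0 : 0 < beta).

(** The predecessor accounts for [v]: of the [#|f| - #|P|] vertices of the edge
    that are dropped, only those other than [v] belong to the colored set. *)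
Definition edge_cost f : K :=
  \sum_(P in singleton_free f) beta^-1 ^+ (#|f| - #|P|).-1.

Lemma edge_cost_ge0 f : 0 <= edge_cost f.
Proof.
by apply: sumr_ge0 => P _; rewrite exprn_ge0 // invr_ge0 ltW.
Qed.

Lemma card_bad_extensions S v f :
    v \notin S -> v \in f -> f \subset v |: S ->
    (forall S', S' \subset S ->
      (#|good_colorings S'|)%:R * beta ^+ #|S :\: S'|
        <= (#|good_colorings S|)%:R) ->
  (#|[set phi in extensions S v | ~~ uniquely_colored phi f]|)%:R
    <= edge_cost f * (#|good_colorings S|)%:R.
Proof.
move=> vS vf fvS growth.
rewrite /edge_cost mulr_suml -sum1_card.
rewrite (partition_big (fun phi : {ffun V -> C} => preim_partition phi f)
  (mem (singleton_free f))) /=; last first.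
  by move=> phi /setIdP[_ /preim_partition_singleton_free].
rewrite natr_sum; apply: ler_sum => P Pf.
have [S' [S'S cardS' bound]] := card_extensions_partition vS vf fvS Pf.
rewrite exprVn mulrC ler_pdivlMr ?exprn_gt0 // -cardS'.
apply: le_trans (growth S' S'S).
rewrite ler_pM2r ?exprn_gt0 // ler_nat sum1dep_card.
apply: leq_trans bound; apply: subset_leq_card.
apply/fintype.subsetP => phi; rewrite in_set.
by move=> /andP[/setIdP[phiE _] phiP]; apply/setIdP.
Qed.

(** Each extension that is not good fails at some edge through [v], so the
    failures are bounded by the sum of the edge costs. *)
Lemma good_colorings_extend S v :
    v \notin S ->
    (max_deg G)%:R + beta + \sum_(f in hedges H | v \in f) edge_cost f
      <= (#|L v|)%:R ->
    (forall S', S' \subset S ->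
      (#|good_colorings S'|)%:R * beta ^+ #|S :\: S'|
        <= (#|good_colorings S|)%:R) ->
  (#|good_colorings S|)%:R * beta <= (#|good_colorings (v |: S)|)%:R.
Proof.
move=> vS sizeL growth.
(* The union bound: each extension that is not good is counted in the failures
   of at least one edge. *)
have ext_le : (#|extensions S v| <= #|good_colorings (v |: S)| +
    \sum_(f in hedges H | (v \in f) && (f \subset v |: S))
      #|[set phi in extensions S v | ~~ uniquely_colored phi f]|)%N.
  rewrite -(cardsID (good_colorings (v |: S))); apply: leq_add.
    by apply: subset_leq_card; exact: subsetIr.
  rewrite -sum1_card.
  under [leqRHS]eq_bigr do rewrite -sum1_card.
  rewrite (exchange_big_dep (mem (extensions S v))) /=; last first.
    by move=> f phi _ /setIdP[].
  rewrite [leqRHS](bigID (mem (good_colorings (v |: S)))) /=.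
  apply: leq_trans (leq_addl _ _).
  rewrite (eq_bigl (fun phi => (phi \in extensions S v)
      && (phi \notin good_colorings (v |: S)))); last first.
    by move=> phi; rewrite in_setD andbC.
  apply: leq_sum => phi /andP[phiE]; rewrite inE => bad.
  rewrite sum1dep_card card_gt0; apply/set0Pn.
  have /existsP[f /and4P[fH vf fvS nuf]] : [exists f,
      [&& f \in hedges H, v \in f, f \subset v |: S
        & ~~ uniquely_colored phi f]].
    apply: contraNT bad => /existsPn noedge.
    apply: good_extension => // f fH vf fvS.
    by have := noedge f; rewrite fH vf fvS /= negbK.
  by exists f; rewrite in_set fH vf fvS; apply/setIdP.
have := card_extensions (leqnn #|L v|) vS.
move=> /leq_trans/(_ (leq_add ext_le (leqnn _))).
rewrite -(ler_nat K) !natrD !natrM natr_sum => key.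
have costs : \sum_(f in hedges H | (v \in f) && (f \subset v |: S))
      (#|[set phi in extensions S v | ~~ uniquely_colored phi f]|)%:R
    <= (\sum_(f in hedges H | v \in f) edge_cost f)
         * (#|good_colorings S|)%:R :> K.
  rewrite mulr_suml [leRHS](bigID (fun f => f \subset v |: S)) /=.
  rewrite -[leLHS]addr0; apply: lerD.
    rewrite [leLHS](eq_bigl (fun f => (f \in hedges H) && (v \in f)
        && (f \subset v |: S))); last by move=> f; rewrite andbA.
    apply: ler_sum => f /andP[/andP[_ vf] fvS].
    exact: card_bad_extensions.
  by apply: sumr_ge0 => f _; rewrite mulr_ge0 // edge_cost_ge0.
have {sizeL} := ler_wpM2r (ler0n K #|good_colorings S|) sizeL.
rewrite !mulrDl => sizeL.
move: key costs sizeL; set g := #|good_colorings S|%:R.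
set g' := #|good_colorings _|%:R.
set bads := \sum_(f in _ | _ && _) _; set cost := \sum_(f in _ | _) _ => *.
rewrite mulrC; lra.
Qed.

Context (list_size_ge : forall v,
  (max_deg G)%:R + beta + \sum_(f in hedges H | v \in f) edge_cost f
    <= (#|L v|)%:R).

(** Induction on the size of [T]: the one-step estimate for adding a vertex to
    [T :\ v] uses this lemma for all subsets of [T :\ v]. *)
Lemma good_colorings_growth S T :
    S \subset T ->
  (#|good_colorings S|)%:R * beta ^+ #|T :\: S| <= (#|good_colorings T|)%:R.
Proof.
move: {2}#|T| (leqnn #|T|) => n; elim: n => [|n IHn] in S T *.
  rewrite leqn0 cards_eq0 => /eqP ->; rewrite subset0 => /eqP ->.
  by rewrite setD0 cards0 expr0 mulr1.
move=> Tn ST; have [TS|] := boolP (T \subset S).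
  have -> : S = T by apply/eqP; rewrite eqEsubset ST TS.
  by rewrite setDv cards0 expr0 mulr1.
case/subsetPn => v vT vS.
have T0n : (#|T :\ v| <= n)%N by move: Tn; rewrite (cardsD1 v T) vT.
have ST0 : S \subset T :\ v by rewrite subsetD1 ST.
have step : (#|good_colorings (T :\ v)|)%:R * beta <= (#|good_colorings T|)%:R.
  rewrite -[in leRHS](setD1K vT); apply: good_colorings_extend => //.
    by rewrite !inE eqxx.
  by move=> S' S'T; exact: IHn.
apply: le_trans step.
have -> : #|T :\: S| = #|(T :\ v) :\: S|.+1.
  by rewrite (cardsD1 v) !inE vT vS /= setDDl setUC -setDDl.
by rewrite exprSr mulrA ler_pM2r //; exact: IHn.
Qed.

Lemma card_good_colorings_ge : beta ^+ #|V| <= (#|good_colorings setT|)%:R.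
Proof.
have := good_colorings_growth (sub0set setT).
rewrite setD0 cardsT; apply: le_trans.
rewrite -[leLHS]mul1r ler_wpM2r ?exprn_ge0 ?(ltW beta_gt0) // ler1n card_gt0.
apply/set0Pn; exists [ffun=> c0]; rewrite inE; apply/goodP; split.
- by move=> x; rewrite inE.
- by move=> x _; rewrite ffunE.
- by move=> x y; rewrite inE.
move=> f fH; rewrite subset0 => /eqP f0.
by case/negP: (hedges_neq0 H); rewrite -f0.
Qed.

End PartialColorings.

(** * Estimates on factorials and exponentials *)

Section Numerics.
Context (K : realType).

(** From [1 - x <= expR (- x)] at [x = 9 / 400], raised to the power 32. *)
Lemma expR_18_25_le : expR (18 / 25) <= 52 / 25 :> K.
Proof.
have h : (391 / 400) ^+ 32 <= expR (- (18 / 25)) :> K.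
  have -> : - (18 / 25) = 32%:R * (- (9 / 400)) :> K by lra.
  rewrite expRM_natl; apply: lerXn2r.
  - by rewrite nnegrE; lra.
  - by rewrite nnegrE expR_ge0.
  - by apply: le_trans (expR_ge1Dx _); lra.
have h' : 25 / 52 <= expR (- (18 / 25)) :> K by apply: le_trans h; lra.
move: h'; rewrite expRN => h'.
have e0 : 0 < expR (18 / 25) :> K := expR_gt0 _.
have : 25 / 52 * expR (18 / 25) <= 1 :> K by rewrite -ler_pdivlMr ?div1r.
lra.
Qed.

(** From [1 + x <= expR x] at [x = 9 / 160], raised to the power 8. *)
Lemma invR_13_20_le : (13 / 20)^-1 <= expR (9 / 20) :> K.
Proof.
have -> : 9 / 20 = 8%:R * (9 / 160) :> K by lra.
rewrite expRM_natl; apply: (@le_trans _ _ ((169 / 160) ^+ 8)); first lra.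
apply: lerXn2r.
- by rewrite nnegrE; lra.
- by rewrite nnegrE expR_ge0.
- by apply: le_trans (expR_ge1Dx _); lra.
Qed.

Lemma bernoulli2 (y : K) n : 0 <= y ->
  1 + n%:R * y + n%:R * (n%:R - 1) / 2 * y ^+ 2 <= (1 + y) ^+ n.
Proof.
move=> y0; elim: n => [|n IHn]; first by rewrite expr0; lra.
rewrite [leRHS]exprS; have y1 : 0 <= 1 + y by lra.
apply: le_trans (ler_wpM2l y1 IHn).
have n0 : (0 : K) <= n%:R * (n%:R - 1).
  by case: n {IHn} => [|n]; rewrite ?mul0r // mulr_ge0 // subr_ge0 ler1n.
rewrite -natr1 -subr_ge0.
set z := n%:R in n0 *.
have -> : (1 + y) * (1 + z * y + z * (z - 1) / 2 * y ^+ 2)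
   - (1 + (z + 1) * y + (z + 1) * (z + 1 - 1) / 2 * y ^+ 2)
   = z * (z - 1) * y ^+ 3 / 2 :> K by field.
by rewrite divr_ge0 // mulr_ge0 // exprn_ge0.
Qed.

(** By induction, since multiplying by [expR (18 / 25)] costs less than the
    growth factor [(1 + 1 / r) ^+ r] of [r ^+ r / r!], which is at least [7 / 3]
    by [bernoulli2].  The base case [r = 3] is tight: it needs
    [expR (18 / 25) ^+ 3 <= 9]. *)
Lemma fact_expR_le2 r : (3 <= r)%N ->
  r`!%:R * expR (18 / 25 * r%:R) <= 2 * r%:R ^+ r :> K.
Proof.
have e0 : 0 < expR (18 / 25) :> K := expR_gt0 _.
have e1 := expR_18_25_le.
rewrite expRM_natr; elim: r => // r IHr.
rewrite leq_eqVlt => /predU1P[<-|].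
  have -> : 3`! = 6%N by [].
  have : expR (18 / 25) ^+ 3 <= (52 / 25) ^+ 3 :> K.
    by apply: lerXn2r; rewrite ?nnegrE; lra.
  lra.
rewrite ltnS => r3; have {}IHr := IHr r3.
have r0 : (0 : K) < r%:R by rewrite ltr0n; lia.
have r3K : (3 : K) <= r%:R by rewrite (ler_nat K 3).
have pow : expR (18 / 25) * r%:R ^+ r <= (r%:R + 1) ^+ r :> K.
  have -> : r%:R + 1 = (1 + r%:R^-1) * r%:R :> K by field; rewrite gt_eqF.
  rewrite exprMn ler_wpM2r ?exprn_ge0 //.
  have rV0 : 0 <= r%:R^-1 :> K by rewrite invr_ge0.
  apply: le_trans (bernoulli2 r rV0).
  have -> : 1 + r%:R * r%:R^-1 + r%:R * (r%:R - 1) / 2 * r%:R^-1 ^+ 2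
    = 5 / 2 - r%:R^-1 / 2 :> K by field; rewrite gt_eqF.
  have : r%:R^-1 <= 3^-1 :> K by rewrite lef_pV2 ?posrE //; lra.
  lra.
rewrite factS natrM exprS [in leRHS]exprS -natr1.
have r10 : 0 <= r%:R + 1 :> K by lra.
have step1 := ler_wpM2l (mulr_ge0 r10 (ltW e0)) IHr.
have step2 := ler_wpM2l (mulr_ge0 r10 (ler0n K 2)) pow.
apply: le_trans (_ : _ <= (r%:R + 1) * expR (18 / 25) * (2 * r%:R ^+ r)) _.
  by apply: le_trans step1; rewrite le_eqVlt; apply/predU1P; left; ring.
apply: le_trans (_ : _ <= (r%:R + 1) * 2 * (r%:R + 1) ^+ r) _.
  by apply: le_trans step2; rewrite le_eqVlt; apply/predU1P; left; ring.
by rewrite le_eqVlt; apply/predU1P; left; ring.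
Qed.

(** The induction step is [expR 1 <= (1 + 1 / m) ^+ m.+1], the [m.+1]-st power
    of [1 - 1 / m.+1 <= expR (- 1 / m.+1)]. *)
Lemma fact_le_expR r : (0 < r)%N ->
  r`!%:R <= r%:R ^+ r.+1 * expR (1 - r%:R) :> K.
Proof.
elim: r => // -[_ _|r IHr _].
  by rewrite subrr expR0 expr1n mulr1.
have {}IHr := IHr isT; move: IHr; set m := r.+1 => IHr.
have m0 : (0 : K) < m%:R by rewrite ltr0n.
have m1 : (0 : K) < m%:R + 1 by lra.
have pow : m%:R ^+ m.+1 <= (m%:R + 1) ^+ m.+1 * expR (-1) :> K.
  have -> : -1 = (m.+1%:R * - (m%:R + 1)^-1) :> K.
    by rewrite -natr1; field; rewrite gt_eqF.
  rewrite expRM_natl -exprMn; apply: lerXn2r.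
  - by rewrite nnegrE ltW.
  - by rewrite nnegrE mulr_ge0 ?expR_ge0 // ltW.
  rewrite [leRHS]mulrC -ler_pdivrMr //; apply: le_trans (expR_ge1Dx _).
  by rewrite le_eqVlt; apply/predU1P; left; field; rewrite gt_eqF.
rewrite factS natrM -natr1.
have -> : 1 - (m%:R + 1) = (1 - m%:R) + -1 :> K by ring.
rewrite expRD exprS.
have step1 := ler_wpM2l (ltW m1) IHr.
have step2 := ler_wpM2l (mulr_ge0 (ltW m1) (expR_ge0 (1 - m%:R))) pow.
apply: le_trans step1 _.
apply: le_trans (_ : _ <= (m%:R + 1) * expR (1 - m%:R) * m%:R ^+ m.+1) _.
  by rewrite le_eqVlt; apply/predU1P; left; ring.
apply: le_trans step2 _.
by rewrite le_eqVlt; apply/predU1P; left; ring.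
Qed.

Lemma sqr_le_expR (l : K) : 10 <= l -> l ^+ 2 <= 13 / 20 * expR l.
Proof.
move=> l10; have l0 : 0 <= l by lra.
have := expR_ge1Dxn 2 l0; have -> : 3`! = 6%N by [].
have := ler_wpM2r (exprn_ge0 2 l0) l10.
rewrite -exprS; have := exprn_ge0 3 l0; lra.
Qed.

Lemma powR_1B_ge (d x : K) :
  d <= 1 / 1000 -> 0 <= x -> expR (- (x / 100)) <= (1 - d) `^ x.
Proof.
move=> d1 x0; have rho0 : 0 < 1 - d by lra.
rewrite /powR gt_eqF // ler_expR -mulrN; apply: ler_wpM2l => //.
rewrite -(expRK (- 100^-1)) ler_ln ?posrE ?expR_gt0 // expRN.
have e1 : 101 / 100 <= expR 100^-1 :> K.
  by apply: le_trans (expR_ge1Dx _); lra.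
apply: le_trans (_ : (101 / 100)^-1 <= _); last lra.
by rewrite lef_pV2 ?posrE ?expR_gt0 //; lra.
Qed.

End Numerics.

(** * The cost of an edge *)

Section EdgeCost.
Import mathcomp.boot.fintype mathcomp.boot.finset.
Context (K : realType) (V : finType).
Implicit Types (f : {set V}) (P : {set {set V}}).

Lemma block_deficit f P : P \in singleton_free f -> (0 < #|f|)%N ->
  (uphalf #|f| <= #|f| - #|P|)%N /\ (0 < #|f| - #|P|)%N.
Proof.
move=> /double_card_singleton_free; move: #|f| #|P| => r k kr r0.
have := uphalf_half r; have := odd_double_half r; move: kr; rewrite -!muln2.
by case: (odd r) => /= kr hr ->; split; lia.
Qed.

Lemma edge_costE (beta : K) f : (0 < #|f|)%N -> 0 < beta ->
  edge_cost beta f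
    = beta * \sum_(P in singleton_free f) beta^-1 ^+ (#|f| - #|P|).
Proof.
move=> f0 b0; rewrite mulr_sumr; apply: eq_bigr => P Pf.
have [_] := block_deficit Pf f0; case: (_ - _)%N => // n _ /=.
by rewrite exprS mulVKf // gt_eqF.
Qed.

Lemma sum_inv_exp_deficit (x : K) f : 0 < x ->
  \sum_(P in singleton_free f) x^-1 ^+ (#|f| - #|P|)
    = singleton_free_poly f x / x ^+ #|f|.
Proof.
move=> x0; rewrite mulr_suml; apply: eq_bigr => P Pf.
have Pn : (#|P| <= #|f|)%N by have := double_card_singleton_free Pf; lia.
by rewrite exprVn expfB_cond ?invf_div // gt_eqF.
Qed.

(** The exponents in the cost are at least [uphalf #|f|] because a
    singleton-free partition has at most [#|f| / 2] blocks.  Hence each power of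
    [beta^-1] is at most [(y / beta) ^+ h] times the same power of [y^-1], and
    for [#|f|] in place of [y] those powers sum to at most 2. *)
Lemma edge_cost_small (beta y : K) f h :
    (3 <= #|f|)%N -> #|f|%:R <= y -> y <= beta -> (h <= uphalf #|f|)%N ->
  edge_cost beta f <= 2 * beta * (y / beta) ^+ h.
Proof.
move=> f3 fy yb hf.
have f0 : (0 < #|f|)%N by lia.
have r0 : (0 : K) < #|f|%:R by rewrite ltr0n.
have y0 : 0 < y by exact: lt_le_trans fy.
have b0 : 0 < beta by exact: lt_le_trans yb.
have q0 : 0 <= y / beta by rewrite divr_ge0 // ltW.
have q1 : y / beta <= 1 by rewrite ler_pdivrMr // mul1r.
rewrite edge_costE // [leRHS]mulrAC mulrC ler_pM2r //.
apply: (@le_trans _ _ ((y / beta) ^+ h *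
  \sum_(P in singleton_free f) #|f|%:R^-1 ^+ (#|f| - #|P|))).
  rewrite mulr_sumr; apply: ler_sum => P Pf.
  have [hP _] := block_deficit Pf f0.
  have betaV : beta^-1 = (y / beta) * y^-1 by field; rewrite !gt_eqF.
  rewrite [in leLHS]betaV exprMn.
  apply: ler_pM; rewrite ?exprn_ge0 ?invr_ge0 ?(ltW y0) //.
    by apply: (ler_wiXn2l q0 q1); exact: leq_trans hP.
  by apply: lerXn2r; rewrite ?nnegrE ?invr_ge0 ?lef_pV2 ?posrE ?(ltW y0).
rewrite mulrC ler_wpM2r ?exprn_ge0 // sum_inv_exp_deficit //.
rewrite ler_pdivrMr ?exprn_gt0 //.
apply: le_trans (singleton_free_poly_le f (ltW r0)) _.
exact: fact_expR_le2.
Qed.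

(** The rate [41 / 500] is [1 - 18 / 25 * (13 / 20) - 9 / 20]: the first term
    comes from [#|f|! <= #|f| ^+ #|f|.+1 * expR (1 - #|f|)], the second from the
    generating polynomial at [13 / 20 * #|f|], and the third bounds
    [- ln (13 / 20)].  The two factors [expR l] bound [beta] and [#|f|]. *)
Lemma edge_cost_large (beta l : K) f :
    (0 < #|f|)%N -> 13 / 20 * #|f|%:R <= beta ->
    #|f|%:R <= expR l -> beta <= expR l ->
  edge_cost beta f <= expR (2 * l + 1 - 41 / 500 * #|f|%:R).
Proof.
move=> f0 bf fl bl; set r := #|f|; pose x : K := 13 / 20 * r%:R.
have r0 : (0 : K) < r%:R by rewrite ltr0n.
have x0 : 0 < x by rewrite /x; lra.
have b0 : 0 < beta by exact: lt_le_trans bf.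
have sum_le : \sum_(P in singleton_free f) beta^-1 ^+ (#|f| - #|P|)
    <= expR (l + 1 - 41 / 500 * r%:R).
  apply: (@le_trans _ _ (singleton_free_poly f x / x ^+ r)).
    rewrite -sum_inv_exp_deficit //; apply: ler_sum => P _.
    apply: lerXn2r; rewrite ?nnegrE ?invr_ge0 ?(ltW b0) ?(ltW x0) //.
    by rewrite lef_pV2 ?posrE.
  rewrite ler_pdivrMr ?exprn_gt0 //.
  apply: le_trans (singleton_free_poly_le f (ltW x0)) _; rewrite -/r.
  apply: le_trans (ler_wpM2r (expR_ge0 _) (fact_le_expR K f0)) _; rewrite -/r.
  have -> : x ^+ r = r%:R ^+ r * ((13 / 20)^-1 ^+ r)^-1.
    by rewrite exprVn invrK -exprMn [in RHS]mulrC.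
  have c0 : (0 : K) < (13 / 20)^-1 by lra.
  rewrite [leRHS]mulrA ler_pdivlMr ?exprn_gt0 //.
  have pow : (13 / 20)^-1 ^+ r <= expR (9 / 20 * r%:R) :> K.
    rewrite expRM_natr; apply: lerXn2r.
    - by rewrite nnegrE ltW.
    - by rewrite nnegrE expR_ge0.
    - exact: invR_13_20_le.
  rewrite -[leLHS]mulrA; apply: le_trans (_ : _ <= r%:R ^+ r.+1 * expR (1 - r%:R)
    * (expR (18 / 25 * x) * expR (9 / 20 * r%:R))) _.
    apply: ler_wpM2l; first by rewrite mulr_ge0 ?exprn_ge0 ?expR_ge0.
    exact: (ler_wpM2l (expR_ge0 _) pow).
  have key : r%:R * (expR (1 - r%:R) * (expR (18 / 25 * x)
      * expR (9 / 20 * r%:R))) <= expR (l + 1 - 41 / 500 * r%:R).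
    apply: le_trans (ler_wpM2r _ fl) _; first by rewrite !mulr_ge0 ?expR_ge0.
    by rewrite -!expRD ler_expR /x; lra.
  rewrite exprS [leRHS]mulrC.
  apply: le_trans (ler_wpM2l (exprn_ge0 r (ltW r0)) key).
  by rewrite le_eqVlt; apply/predU1P; left; ring.
rewrite edge_costE //; apply: (@le_trans _ _
  (expR l * expR (l + 1 - 41 / 500 * r%:R))).
  apply: ler_pM => //; first exact: ltW.
  by apply: sumr_ge0 => P _; rewrite exprn_ge0 // invr_ge0 ltW.
by rewrite -expRD ler_expR; lra.
Qed.

End EdgeCost.

(** * From edge costs to list colorings *)

Lemma min_rank_le (V : finType) (H : hypergraph V) (f : {set V}) v :
  f \in hedges H -> v \in f -> (min_rank H v <= #|f|)%N.
Proof.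
move=> fH vf; rewrite /min_rank -minEnat -leEnat.
by apply: bigmin_le_cond; rewrite fH vf.
Qed.

(** Small edges are charged to the first term of the weight and large edges to
    the second.  In the large case the exponent of the cost,
    [2 * l + 1 - 41 / 500 * l ^+ 2], only has to be below [- l ^+ 2 / 100]. *)
Lemma edge_cost_le_weight (K : realType) (V : finType) (H : hypergraph V)
    (R : nat) (beta : K) (f : {set V}) v :
    f \in hedges H -> v \in f -> (3 <= #|f|)%N -> (#|f| <= R)%N ->
    13 / 20 * R%:R <= beta -> beta <= R%:R -> 1000 <= ln (R%:R : K) ->
  edge_cost beta f <= weight R beta H v.
Proof.
move=> fH vf f3 fR Rb bR; set l := ln _ => l1000.
have R0 : (0 : K) < R%:R.
  by rewrite ltr0n; apply: leq_trans fR; exact: leq_trans f3.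
have b0 : 0 < beta by lra.
have Rl : R%:R = expR l :> K by rewrite lnK.
have fRK : #|f|%:R <= R%:R :> K by rewrite ler_nat.
rewrite /weight -/l le_max; apply/orP.
have [fl|lf] := leP (#|f|%:R : K) (l ^+ 2); [left|right].
  set k := uphalf _.
  have kf : (k <= uphalf #|f|)%N by rewrite uphalf_leq // min_rank_le.
  have lb : l ^+ 2 <= beta.
    by apply: le_trans (sqr_le_expR _) _; [lra|rewrite -Rl].
  apply: le_trans (edge_cost_small f3 fl lb kf) _.
  rewrite expfzDr ?gt_eqF // expr1z -exprnN exprM expr_div_n.
  by rewrite [X in _ * X <= _]mulrC -!mulrA lexx.
have f0 : (0 < #|f|)%N by exact: leq_trans f3.
have bf : 13 / 20 * #|f|%:R <= beta by lra.
have fl : #|f|%:R <= expR l by rewrite -Rl.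
have bl : beta <= expR l by rewrite -Rl.
apply: le_trans (edge_cost_large f0 bf fl bl) _.
have d1 : 10 ^- 8 <= 1 / 1000 :> K by lra.
have l0 : 0 <= l by lra.
have ll := ler_wpM2r l0 l1000; rewrite -expr2 in ll.
apply: le_trans (powR_1B_ge d1 (exprn_ge0 2 l0)).
by rewrite ler_expR; lra.
Qed.

Local Open Scope classical_set_scope.
Local Open Scope ring_scope.

(** The lists are cut down to finite lists of exactly [a] colors, so that all
    the colors lie in a common ordinal, where good colorings can be counted. *)
Lemma at_least_pcf_list_colorings (K : realType) (V : finType) (G : graph V)
    (H : hypergraph V) (beta : K) (a : nat) (L : V -> set nat) :
    0 < beta -> assignment a L ->
    (forall v, (max_deg G)%:R + beta
       + \sum_(f in hedges H | v \in f) edge_cost beta f <= a%:R) ->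
  at_least (beta ^+ #|V|) (pcf_list_colorings G H L).
Proof.
move=> b0 hL size_ge.
have /choice[e eP] v : exists e : nat -> nat,
    set_fun `I_a (L v) e /\ set_inj `I_a e.
  have [_ /pcard_leP/injfunPex[e ? ?]] := hL v.
  by exists e.
pose N := (\max_(v : V) \max_(i < a) e v i)%N.
have eN v (i : 'I_a) : (e v i <= N)%N.
  apply: (@leq_trans (\max_(i < a) e v i)%N).
    exact: (@leq_bigmax _ (fun i : 'I_a => e v i) i).
  exact: (@leq_bigmax _ (fun v => \max_(i < a) e v i)%N v).
pose M v : {set 'I_N.+1} := [set inord (e v i) | i : 'I_a]%SET.
have cardM v : #|M v| = a.
  rewrite card_imset ?card_ord // => i j /(congr1 val).
  rewrite /= !inordK ?ltnS // => eij; apply: val_inj.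
  by apply: (eP v).2 eij; rewrite inE /=.
have main := @card_good_colorings_ge V _ ord0 G H M K beta b0.
exists #|good_colorings ord0 G H M finset.setT|.
  by apply: main => v; rewrite cardM.
pose s := enum (good_colorings ord0 G H M finset.setT).
pose F i : {ffun V -> nat} := [ffun x => val (nth [ffun=> ord0] s i x)].
suff [g] : $|{injfun `I_#|good_colorings ord0 G H M finset.setT|
    >-> pcf_list_colorings G H L}| by exact: inj_card_le g.
apply/injfunPex; exists F.
  move=> i /= i_lt.
  have : nth [ffun=> ord0] s i \in s by rewrite mem_nth // -cardE.
  rewrite mem_enum inE /F; set phi := nth _ _ _ => /goodP[phiM _ phiP phiC].
  split.
  - move=> v w vw; rewrite !ffunE => /val_inj/eqP.
    by apply/negP; apply: phiP; rewrite ?finset.in_setT.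
  - move=> f fH; have /existsP[c /eqP fc] := phiC f fH (finset.subsetT f).
    exists (val c); rewrite -fc; congr (#|pred_of_set _|).
    by apply/finset.setP => x; rewrite !inE ffunE.
  - move=> v; rewrite ffunE.
    have /imsetP[j _ ->] := phiM v (finset.in_setT v).
    by rewrite /= inordK ?ltnS //; apply: (eP v).1 => /=.
move=> i j; rewrite !inE /= => i_lt j_lt /ffunP eqF.
apply/eqP; rewrite -(@nth_uniq _ [ffun=> ord0] s) ?enum_uniq -?cardE //.
by apply/eqP/ffunP => x; apply: val_inj; have := eqF x; rewrite !ffunE.
Qed.

Theorem theorem4 (K : realType) (R : nat) (hR0 : (0 < R)%N)
  (V : finType) (G : graph V) (H : hypergraph V)
  (hrank : (rank H <= R)%N)
  (hedge : forall f : {set V}, f \in hedges H -> (3 <= #|f|)%N)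
  (beta : K)
  (hbeta1 : (655 / 10 ^+ 3 + 826 / 10 ^+ 7) * R%:R <= beta)
  (hbeta2 : beta <= R%:R)
  (hR : expR (31 * 10 ^+ 7) <= R%:R :> K)
  (L : V -> set nat)
  (hL : assignment `|list_size R beta G H|%N L) :
  at_least (beta ^+ #|V|) (pcf_list_colorings G H L).
Proof.
have R0 : (0 : K) < R%:R by rewrite ltr0n.
have Rb : 13 / 20 * R%:R <= beta by lra.
have b0 : 0 < beta by lra.
have l1000 : 1000 <= ln (R%:R : K).
  apply: (@le_trans _ _ (31 * 10 ^+ 7)); first lra.
  by rewrite -(expRK (31 * _)) ler_ln ?posrE ?expR_gt0.
have cost v : \sum_(f in hedges H | v \in f) edge_cost beta f
    <= (hdeg H v)%:R * weight R beta H v.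
  rewrite /hdeg mulr_natl -sumr_const [leRHS](eq_bigl
    (fun f : {set V} => (f \in hedges H) && (v \in f))); last first.
    by move=> f; rewrite finset.in_set.
  apply: ler_sum => f /andP[fH vf]; apply: edge_cost_le_weight => //.
    exact: hedge.
  by apply: leq_trans hrank; rewrite /rank (bigD1 f) //= leq_maxl.
have size_ge v : (max_deg G)%:R + beta
    + \sum_(f in hedges H | v \in f) edge_cost beta f
      <= `|list_size R beta G H|%N%:R.
  apply: (@le_trans _ _ (list_size R beta G H)%:~R); last first.
    by rewrite natr_absz ler_int ler_norm.
  apply: le_trans (ceil_ge _); rewrite lerD2l; apply: le_trans (cost v) _.
  exact: (le_bigmax _ (fun v => (hdeg H v)%:R * weight R beta H v)).
exact: (at_least_pcf_list_colorings b0 hL).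
Qed.
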